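(* Let $R$ be a commutative noetherian ring of prime characteristic $p>0$, let $I,\mathfrak{a}\subset R$ be ideals, and let $t\in\mathbb{Q}_{>0}$. Then $I^{*\mathfrak{a}^t}\subset(I^*:\mathfrak{a}_t)$.
   Context: All rings are commutative with unit and noetherian. $R^\circ$ is the set of elements of $R$ not in any minimal prime of $R$. $I^{[p^e]}$ is the ideal generated by $\{r^{p^e}\mid r\in I\}$. The tight closure of $I$ is $I^*=\{x\in R\mid \text{for some }c\in R^\circ\text{ and all }e\gg0,\ cx^{p^e}\in I^{[p^e]}\}$. The Hara-Yoshida $\mathfrak{a}^t$-tight closure of $I$ is $$I^{*\mathfrak{a}^t}=\{x\in R\mid \text{for some }c\in R^\circ\text{ and all }e\gg0,\ cx^{p^e}\mathfrak{a}^{\lceil tp^e\rceil}\subset I^{[p^e]}\}.$$ For $t=r/s\in\mathbb{Q}_{\ge0}$ ($r,s$ integers, $r\ge0$, $s>0$) the $t$-th rational power of $\mathfrak{a}$ is $\mathfrak{a}_t=\{x\in R\mid x^s\in\overline{\mathfrak{a}^r}\}$, where the bar denotes usual integral closure. *)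

(* Defs.v *)
From mathcomp Require Import all_boot all_order all_algebra.
From mathcomp Require Import boolp classical_sets.

Set Implicit Arguments.
Unset Strict Implicit.
Unset Printing Implicit Defensive.

Import Order.TTheory GRing.Theory Num.Theory.

Local Open Scope classical_set_scope.
Local Open Scope ring_scope.

(* The ideals of MathComp's ring_quotient are decidable and proper; the ideals
   below are arbitrary subsets and may be the whole ring. *)
Definition is_ideal (R : comNzRingType) (I : set R) : Prop :=
  [/\ I 0,
      forall x y, I x -> I y -> I (x + y)
    & forall a x, I x -> I (a * x)].

Definition ideal_gen (R : comNzRingType) (S : set R) : set R :=
  smallest (@is_ideal R) S.

Definition noetherian_ring (R : comNzRingType) : Prop :=
  forall I : set R, is_ideal I -> exists s : seq R, I = ideal_gen [set` s].

Definition ideal_mul (R : comNzRingType) (I J : set R) : set R :=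
  ideal_gen [set z | exists x y, [/\ I x, J y & z = x * y]].

Definition ideal_exp (R : comNzRingType) (I : set R) (n : nat) : set R :=
  iter n (ideal_mul I) setT.

Definition ideal_colon (R : comNzRingType) (I J : set R) : set R :=
  [set x | forall y, J y -> I (x * y)].

Definition is_prime_ideal (R : comNzRingType) (P : set R) : Prop :=
  [/\ is_ideal P, ~ P 1 & forall x y, P (x * y) -> P x \/ P y].

Definition is_minimal_prime (R : comNzRingType) (P : set R) : Prop :=
  is_prime_ideal P /\
  forall Q : set R, is_prime_ideal Q -> Q `<=` P -> Q = P.

(* The set R° *)
Definition ring_circ (R : comNzRingType) : set R :=
  [set c | forall P : set R, is_minimal_prime P -> ~ P c].

(* I^[q], used for q = p ^ e *)
Definition frobenius_power (R : comNzRingType) (I : set R) (q : nat) : set R :=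
  ideal_gen [set r ^+ q | r in I].

Definition tight_closure (R : comNzRingType) (p : nat) (I : set R) : set R :=
  [set x | exists2 c : R, ring_circ c &
     exists e0 : nat, forall e : nat, (e0 <= e)%N ->
       frobenius_power I (p ^ e) (c * x ^+ (p ^ e))].

(* I^{*a^t}, for 0 <= t: the integer ceiling is then nonnegative, and absz
   only casts it to nat. *)
Definition at_tight_closure (R : comNzRingType) (p : nat) (a : set R) (t : rat)
    (I : set R) : set R :=
  [set x | exists2 c : R, ring_circ c &
     exists e0 : nat, forall e : nat, (e0 <= e)%N ->
       forall y : R, ideal_exp a `|Num.ceil (t * (p ^ e)%:R)|%N y ->
         frobenius_power I (p ^ e) (c * x ^+ (p ^ e) * y)].

Definition integral_closure (R : comNzRingType) (I : set R) : set R :=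
  [set x | exists (n : nat) (b : nat -> R),
     [/\ (0 < n)%N,
         forall i : nat, (1 <= i <= n)%N -> ideal_exp I i (b i)
       & x ^+ n + \sum_(1 <= i < n.+1) b i * x ^+ (n - i) = 0]].

(* The condition x ^+ s \in integral_closure (a ^ r) does not depend on the
   fraction r / s representing t, so every representation is allowed. *)
Definition rational_power (R : comNzRingType) (a : set R) (t : rat) : set R :=
  [set x | exists r s : nat,
     [/\ (0 < s)%N, t = r%:R / s%:R
       & integral_closure (ideal_exp a r) (x ^+ s)]].

(* Main.v *)
Require Import Defs.
From mathcomp Require Import all_boot all_order all_algebra.
From mathcomp Require Import boolp classical_sets.
From mathcomp Require Import ring zify.

(** Let y be in a_t and x in I^{*a^t}, so c x^q a^{ceil(tq)} lies in I^[q] for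
    all large q = p^e.

    Clearing the integral equation of y^s over a^r gives a constant N, not
    depending on q, with y^(q + N) in a^{ceil(tq)} ([rational_power_exp]).  If y
    is in R°, the multiplier c y^N thus shows that x y is in I^*.  In general y
    may lie in some minimal primes, and the multiplier has to be corrected
    there: there are w and k with w^k y^k = 0 such that every minimal
    prime contains exactly one of y and w ([exists_complement]).  Then
    d = y^(N + 1) + w^k is in R°, while d y^q = y^(q + N + 1) for q >= k, because
    the term w^k y^q vanishes.  So c d is a multiplier for x y.

    Modulo the nilradical, w is an annihilator of y such that y + w is a
    nonzerodivisor.  It is found without decomposing the nilradical into
    finitely many primes: take w for which the double annihilator of w is
    maximal.  If z kills y + w then z kills both y and w, and w + z is an
    annihilator of y whose double annihilator contains both that of w and z.
    By maximality z is in the double annihilator of w; since z kills w, it kills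
    itself, so z = 0 modulo the nilradical.  That a nonzerodivisor modulo the
    nilradical avoids every minimal prime is the usual localization argument, in
    the form of a prime ideal disjoint from a multiplicative set
    ([prime_avoiding]). *)

Local Open Scope classical_set_scope.
Local Open Scope ring_scope.

Import Order.TTheory GRing.Theory Num.Theory.

(** * Ideals and their powers *)

Section Ideals.
Context {R : comNzRingType}.
Implicit Types (I J P : set R) (x y z : R).

Lemma ideal0 {I} : is_ideal I -> I 0.
Proof. by case. Qed.

Lemma idealD {I x y} : is_ideal I -> I x -> I y -> I (x + y).
Proof. by case=> _ hD _; apply: hD. Qed.

Lemma idealMl {I} a {x} : is_ideal I -> I x -> I (a * x).
Proof. by case=> _ _; apply. Qed.

Lemma idealMr {I} a {x} : is_ideal I -> I x -> I (x * a).
Proof. by rewrite mulrC; apply: idealMl. Qed.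

Lemma idealN {I x} : is_ideal I -> I x -> I (- x).
Proof. by rewrite -mulN1r; apply: idealMl. Qed.

Lemma ideal_gen_ideal (S : set R) : is_ideal (ideal_gen S).
Proof.
split=> [J [hJ _]|x y hx hy J hJ|b x hx J hJ].
- exact: ideal0.
- by apply: idealD (hx _ hJ) (hy _ hJ); case: hJ.
- by apply: idealMl (hx _ hJ); case: hJ.
Qed.

Lemma ideal_exp_ideal I n : is_ideal (ideal_exp I n).
Proof. by case: n => [|n]; [split | apply: ideal_gen_ideal]. Qed.

Lemma ideal_exp_mul {I m n x y} :
  ideal_exp I m x -> ideal_exp I n y -> ideal_exp I (m + n) (x * y).
Proof.
move=> hx; elim: m x hx y => [|m IHm] x hx y hy.
  exact: idealMl (ideal_exp_ideal I n) hy.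
move: x hx y hy.
pose C := [set x | forall y, ideal_exp I n y -> ideal_exp I (m.+1 + n) (x * y)].
suff: ideal_exp I m.+1 `<=` C by [].
have hE := ideal_exp_ideal I (m.+1 + n).
apply: smallest_sub => [|_ [u [v [hu hv ->]]] y hy].
  split=> [y _|x x' hx hx' y hy|b x hx y hy].
  - by rewrite mul0r; apply: (ideal0 hE).
  - by rewrite mulrDl; apply: (idealD hE); [apply: hx | apply: hx'].
  - by rewrite -mulrA; apply: (idealMl _ hE); apply: hx.
rewrite -mulrA addSn; apply: sub_gen_smallest.
by exists u, (v * y); split=> //; apply: IHm.
Qed.

Lemma ideal_exp_anti {I m n} : (m <= n)%N -> ideal_exp I n `<=` ideal_exp I m.
Proof.
move=> /subnKC <-; elim: (n - m)%N => [|k IHk]; first by rewrite addn0.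
rewrite addnS; apply: subset_trans IHk; apply: smallest_sub.
  exact: ideal_exp_ideal.
by move=> _ [u [v [_ hv ->]]]; apply: idealMl (ideal_exp_ideal I _) hv.
Qed.

Lemma ideal_exp_exp I r m : ideal_exp (ideal_exp I r) m `<=` ideal_exp I (r * m).
Proof.
elim: m => [|m IHm]; first by rewrite muln0.
apply: smallest_sub; first exact: ideal_exp_ideal.
move=> _ [u [v [hu hv ->]]]; rewrite mulnS.
by apply: ideal_exp_mul hu _; apply: IHm.
Qed.

End Ideals.

(** * Integral closure and rational powers *)

(** The equation of degree n for z rewrites any power z^k with k >= n through
    lower powers of z, each lost factor z^i being paid for by an element of
    J^i.  Only the first n factors of z^k are therefore wasted. *)
Lemma integral_closure_exp {R : comNzRingType} {J : set R} {z : R} :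
  integral_closure J z ->
  exists n : nat, forall m : nat, ideal_exp J m (z ^+ (m + n)).
Proof.
move=> [n [b [n_gt0 hb eqn]]]; exists n.
suff H k : ideal_exp J (k - n) (z ^+ k) by move=> m; have := H (m + n)%N; rewrite addnK.
elim/ltn_ind: k => k IHk.
have [le_kn|lt_nk] := leqP k n.
  by rewrite (eqP le_kn).
have hE := ideal_exp_ideal J (k - n).
have -> : z ^+ k = - \sum_(1 <= i < n.+1) b i * z ^+ (k - i).
  rewrite -{1}(subnK (ltnW lt_nk)) exprD.
  move/eqP: eqn; rewrite addr_eq0 => /eqP ->; rewrite mulrN mulr_sumr.
  congr (- _); apply: eq_big_nat => i /andP[_ le_in].
  rewrite mulrCA -exprD; congr (_ * _ ^+ _); lia.
apply: idealN => //.
rewrite big_nat; apply: big_ind => [||i hi].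
- exact: ideal0.
- by move=> u v; apply: idealD.
have lt_k : (k - i < k)%N by lia.
have := ideal_exp_mul (hb i hi) (IHk _ lt_k).
by apply: ideal_exp_anti; lia.
Qed.

Lemma rational_power_exp {R : comNzRingType} {a : set R} {t : rat} {y : R} :
  0 < t -> rational_power a t y ->
  exists N : nat, forall q : nat,
    ideal_exp a `|Num.ceil (t * q%:R)|%N (y ^+ (q + N)).
Proof.
move=> t_gt0 [r [s [s_gt0 def_t /integral_closure_exp[n hn]]]].
exists (s * n.+1)%N => q.
pose m := (q %/ s).+1.
have le_ceil : (`|Num.ceil (t * q%:R)| <= r * m)%N.
  have : Num.ceil (t * q%:R) <= (r * m)%N%:Z.
    rewrite ceil_le_int def_t mulrAC ler_pdivrMr ?ltr0n //.
    rewrite -pmulrn -!natrM ler_nat -mulnA leq_mul2l.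
    by rewrite (ltnW (ltn_ceil q s_gt0)) orbT.
  have : 0 <= Num.ceil (t * q%:R).
    by rewrite ceil_ge0 (lt_le_trans (ltrN10 _)) // mulr_ge0 ?ler0n // ltW.
  lia.
apply: ideal_exp_anti le_ceil _ _.
have -> : (q + s * n.+1 = q %% s + s * (m + n))%N.
  by rewrite {1}(divn_eq q s) /m; lia.
rewrite exprD exprM; apply: idealMl; first exact: ideal_exp_ideal.
exact: ideal_exp_exp (hn m).
Qed.

(** * Primes in a noetherian ring *)

Section Primes.
Context {R : comNzRingType}.
Implicit Types (P Q : set R) (x y z w c : R).

Lemma prime_exp {P x n} : is_prime_ideal P -> P (x ^+ n) -> P x.
Proof.
move=> [_ P1 hP]; elim: n => [/P1 //|n IHn].
by rewrite exprS => /hP[].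
Qed.

Lemma prime_summand {P x y} : is_prime_ideal P -> P (x * y) -> P (x + y) -> P x.
Proof.
move=> [hI _ hP] /hP[//|hy hxy].
by rewrite -(addrK y x); apply: idealD => //; apply: idealN.
Qed.

Lemma ring_circM {c d} : @ring_circ R c -> ring_circ d -> ring_circ (c * d).
Proof.
by move=> hc hd P hP; case: (hP) => -[_ _ PM] _ /PM[/hc|/hd]; apply.
Qed.

(** The empty set is added to the family so that the empty chain has an upper
    bound; the union of a nonempty chain of ideals is generated by finitely many
    elements, all of which already lie in one member. *)
Lemma noetherian_maximal {F : set (set R)} {I0 : set R} :
  noetherian_ring R -> F `<=` @is_ideal R -> F I0 ->
  exists2 A, F A & forall B, F B -> A `<=` B -> B `<=` A.
Proof.
move=> hR Fideal FI0.
have [|A [FA maxA]] := @Zorn_bigcup R [set A | A = set0 \/ F A].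
  move=> G GF totG.
  have [->|/set0P[x0 [A0 GA0 A0x0]]] := eqVneq (\bigcup_(X in G) X) set0.
    by left.
  right; set U := \bigcup_(X in G) X.
  have memF A x : G A -> A x -> F A by move=> /GF[-> []|].
  have Uideal : is_ideal U.
    split=> [|x y [A GA Ax] [B GB By]|b x [A GA Ax]].
    - by exists A0 => //; exact: ideal0 (Fideal _ (memF _ _ GA0 A0x0)).
    - have [AB|BA] := totG _ _ GA GB.
        by exists B => //; exact: idealD (Fideal _ (memF _ _ GB By)) (AB _ Ax) By.
      by exists A => //; exact: idealD (Fideal _ (memF _ _ GA Ax)) Ax (BA _ By).
    - by exists A => //; exact: idealMl (Fideal _ (memF _ _ GA Ax)) Ax.
  have [gens defU] := hR U Uideal.
  have gensU : [set` gens] `<=` U by rewrite defU; apply: sub_gen_smallest.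
  have [A GA [FA gensA]] : exists2 A, G A & F A /\ [set` gens] `<=` A.
    clear defU; elim: gens gensU => [_|x gens IH gensU].
      by exists A0 => //; split=> //; exact: memF GA0 A0x0.
    have [|A GA [FA gensA]] := IH.
      by move=> z hz; apply: gensU; rewrite /= inE hz orbT.
    have [B GB Bx] : U x by apply: gensU; rewrite /= inE eqxx.
    have [AB|BA] := totG _ _ GA GB.
      exists B => //; split; first exact: memF GB Bx.
      by move=> z; rewrite /= inE => /orP[/eqP ->|/gensA /AB].
    exists A => //; split=> // z; rewrite /= inE => /orP[/eqP ->|/gensA //].
    exact: BA.
  have -> // : U = A.
  apply/seteqP; split; last by move=> z Az; exists A.
  by rewrite defU; apply: smallest_sub => //; apply: Fideal.
case: FA => [A0|FA].
  case: (maxA I0); last by right.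
  rewrite A0; split=> // /(_ 0) H; apply: H.
  exact/ideal0/Fideal.
exists A => // B FB AB; apply: contrapT => nBA.
by apply: (maxA B); [split | right].
Qed.

Lemma prime_avoiding {S : set R} :
  noetherian_ring R -> S 1 -> (forall x y, S x -> S y -> S (x * y)) -> ~ S 0 ->
  exists2 P, is_prime_ideal P & forall x, P x -> ~ S x.
Proof.
move=> hR S1 SM S0.
pose F := [set A : set R | is_ideal A /\ forall x, A x -> ~ S x].
have [||P [hP PS] maxP] := @noetherian_maximal F [set 0] hR.
- by move=> A [].
- split=> [|x -> //]; split=> [//|x y -> ->|b x ->]; first by rewrite addr0.
  by rewrite mulr0.
exists P => //.
have hits x : ~ P x -> exists u b, P u /\ S (u + b * x).
  move=> nPx; apply: contrapT => no.
  pose B := [set z | exists u b, P u /\ z = u + b * x].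
  apply: nPx; apply: (maxP B).
  - split.
      split=> [|_ _ [u [b [Pu ->]]] [v [d [Pv ->]]]|e _ [u [b [Pu ->]]]].
      + by exists 0, 0; rewrite mul0r addr0; split=> //; apply: ideal0.
      + by exists (u + v), (b + d); split; [apply: idealD | ring].
      + by exists (e * u), (e * b); split; [apply: idealMl | ring].
    by move=> _ [u [b [Pu ->]]] Sz; apply: no; exists u, b.
  - by move=> u Pu; exists u, 0; rewrite mul0r addr0.
  - by exists 0, 1; rewrite mul1r add0r; split=> //; apply: ideal0.
split=> // [/PS //|x y Pxy].
apply: contrapT => /not_orP[/hits[u [b [Pu Su]]] /hits[v [d [Pv Sv]]]].
apply: PS (SM _ _ Su Sv).
have -> : (u + b * x) * (v + d * y) = (v + d * y) * u + (b * x) * v + (b * d) * (x * y).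
  by ring.
by apply: idealD; [|apply: idealD|] => //; apply: idealMl.
Qed.

(** Working with the intersection of all primes makes every closure property
    of the nilradical a statement about one prime at a time; it is compared
    with nilpotency only in [nilradical_exp]. *)
Definition nilradical : set R := [set x | forall P, is_prime_ideal P -> P x].

Lemma nilradical_exp {x} :
  noetherian_ring R -> nilradical x -> exists n : nat, x ^+ n = 0.
Proof.
move=> hR Nx; apply: contrapT => no.
have [||[n /esym xn0]|P hP PS] := @prime_avoiding [set z | exists n : nat, z = x ^+ n] hR.
- by exists 0%N.
- by move=> _ _ [m ->] [n ->]; exists (m + n)%N; rewrite exprD.
- by apply: no; exists n.
- by apply: PS (Nx _ hP) _; exists 1%N.
Qed.

(** If a minimal prime P contained c, a prime avoiding the multiplicative set
    of all s c^k with s outside P would be strictly smaller than P. *)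
Lemma nonzerodivisor_ring_circ c :
  noetherian_ring R -> (forall z, nilradical (z * c) -> nilradical z) ->
  ring_circ c.
Proof.
move=> hR nzd P [hP minP] Pc.
have [hI P1 PM] := hP.
pose S := [set z | exists s k, ~ P s /\ z = s * c ^+ k].
have [||[s [k [nPs s0]]]|Q hQ QS] := @prime_avoiding S hR.
- by exists 1, 0%N; rewrite expr0 mulr1.
- move=> _ _ [s [k [nPs ->]]] [s' [k' [nPs' ->]]].
  exists (s * s'), (k + k')%N; split; first by move=> /PM[].
  by rewrite exprD; ring.
- apply: nPs; apply: nzd (hP) => Q hQ.
  have [QI _ QM] := hQ.
  have : Q (s * c ^+ k) by rewrite -s0; apply: ideal0.
  by move=> /QM[Qs|/(prime_exp hQ) Qc]; [apply: idealMr | apply: idealMl].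
have defQ : Q = P.
  apply: minP => // z Qz; apply: contrapT => nPz; apply: QS Qz _.
  by exists z, 0%N; rewrite expr0 mulr1.
apply: (QS c); first by rewrite defQ.
by exists 1, 1%N; rewrite mul1r expr1.
Qed.

(** The double annihilators modulo the nilradical are used instead of the
    annihilators because the ascending chain condition is needed on a family
    that grows with w. *)
Lemma exists_complement y :
  noetherian_ring R ->
  exists w, nilradical (w * y) /\ ring_circ (y + w).
Proof.
move=> hR.
pose ann2 w := [set z | forall v, nilradical (v * w) -> nilradical (v * z)].
have ann2_ideal w : is_ideal (ann2 w).
  split=> [v _ P hP|z z' hz hz' v hv P hP|b z hz v hv P hP]; have [hI _ _] := hP.
  - by rewrite mulr0; apply: ideal0.
  - by rewrite mulrDr; apply: idealD (hz v hv P hP) (hz' v hv P hP).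
  - by rewrite mulrCA; apply: idealMl (hz v hv P hP).
pose F := [set A | exists2 w, nilradical (w * y) & A = ann2 w].
have [||_ [w Nwy ->] maxw] := @noetherian_maximal F (ann2 0) hR.
- by move=> _ [w _ ->].
- by exists 0 => // P [hI _ _]; rewrite mul0r; apply: ideal0.
exists w; split=> //; apply: nonzerodivisor_ring_circ => // z Nzc.
have Nz P : is_prime_ideal P -> P z \/ P y /\ P w.
  move=> hP; have [_ _ PM] := hP.
  case: (PM _ _ (Nzc P hP)) => [|Pyw]; [by left | right].
  have Pwy := Nwy P hP; split.
    by apply: prime_summand hP _ Pyw; rewrite mulrC.
  by apply: prime_summand hP Pwy _; rewrite addrC.
(* z kills w, so a multiple of w + z is zero only if its two parts are. *)
have Nsum v : nilradical (v * (w + z)) -> nilradical (v * w) /\ nilradical (v * z).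
  move=> Nv; suff H P : is_prime_ideal P -> P (v * w) /\ P (v * z).
    by split=> Q /(H Q)[].
  move=> hP; have [hI _ PM] := hP.
  case: (PM _ _ (Nv P hP)) => [Pv|Pwz]; first by split; apply: idealMr.
  have Pzw : P (z * w).
    by case: (Nz P hP) => [|[_]]; [apply: idealMr | apply: idealMl].
  split; apply: idealMl => //.
    by apply: prime_summand hP _ Pwz; rewrite mulrC.
  by apply: prime_summand hP Pzw _; rewrite addrC.
have z_ann2 : ann2 w z.
  apply: (maxw (ann2 (w + z))).
  - exists (w + z) => // P hP; have [hI _ _] := hP; rewrite mulrDl.
    apply: idealD (Nwy P hP) _ => //.
    by case: (Nz P hP) => [|[]]; [apply: idealMr | move=> ? _; apply: idealMl].
  - by move=> u hu v /Nsum[/hu].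
  - by move=> v /Nsum[].
have Nzz : nilradical (z * z).
  apply: z_ann2 => P hP; have [hI _ _] := hP.
  by case: (Nz P hP) => [|[_]]; [apply: idealMr | apply: idealMl].
by move=> P hP; apply: (@prime_exp _ _ 2 hP); apply: Nzz.
Qed.

(** Every minimal prime contains exactly one of y and w, a property which
    passes to their positive powers. *)
Lemma ring_circ_expD {y w} m n :
  nilradical (w * y) -> ring_circ (y + w) -> ring_circ (y ^+ m.+1 + w ^+ n.+1).
Proof.
move=> Nwy cyw P minP Pd; apply: (cyw P minP).
have [hP _] := minP; have [hI _ PM] := hP.
have Pprod : P (y ^+ m.+1 * w ^+ n.+1).
  have -> : y ^+ m.+1 * w ^+ n.+1 = y ^+ m * w ^+ n * (w * y).
    by rewrite !exprS; ring.
  exact: idealMl (Nwy P hP).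
have Py : P y by apply: (prime_exp hP); exact: prime_summand hP Pprod Pd.
apply: idealD hI Py _.
rewrite mulrC in Pprod; rewrite addrC in Pd.
by apply: (prime_exp hP); exact: prime_summand hP Pprod Pd.
Qed.

End Primes.

Theorem proposition3p12 (R : comNzRingType) (p : nat) (I a : set R) (t : rat)
  (hR : noetherian_ring R) (hp : p \in [pchar R])
  (hI : is_ideal I) (ha : is_ideal a) (ht : 0 < t) :
  at_tight_closure p a t I `<=`
    ideal_colon (tight_closure p I) (rational_power a t).
Proof.
move=> x [c hc [e0 he0]] y hy.
have [N hN] := rational_power_exp ht hy.
have [w [Nwy cyw]] := exists_complement y hR.
have [k wyk] := nilradical_exp hR Nwy.
exists (c * (y ^+ N.+1 + w ^+ k.+1)).
  exact: ring_circM hc (ring_circ_expD _ _ Nwy cyw).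
exists (maxn e0 k.+1) => e; rewrite geq_max => /andP[le_e0 lt_ke].
set q := (p ^ e)%N.
have lt_kq : (k < q)%N.
  apply: leq_trans lt_ke (ltnW (ltn_expl _ _)).
  exact/prime_gt1/(pcharf_prime hp).
have wyq : w ^+ k.+1 * y ^+ q = 0.
  have -> : w ^+ k.+1 * y ^+ q = w * y ^+ (q - k) * (w * y) ^+ k.
    by rewrite exprMn exprS -{1}(subnK (ltnW lt_kq)) exprD; ring.
  by rewrite wyk mulr0.
have -> : c * (y ^+ N.+1 + w ^+ k.+1) * (x * y) ^+ q
        = c * x ^+ q * (y * y ^+ (q + N)) + c * x ^+ q * (w ^+ k.+1 * y ^+ q).
  by rewrite exprMn exprD exprS; ring.
rewrite wyq mulr0 addr0; apply: he0 => //.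
by apply: idealMl; [apply: ideal_exp_ideal | apply: hN].
Qed.
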